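(* For any graph $G$, if there exists an $H\in\mathcal{N}(G)$ with a prime labeling, then $G$ is neighborhood-prime.
   Context: All graphs are finite and simple; $[n]=\{1,\dots,n\}$; $N(v)$ is the set of neighbors of $v$ in $G$. A prime labeling of a graph $H$ of order $n$ is a bijection $f:V(H)\to[n]$ such that $\gcd(f(u),f(w))=1$ for every edge $uw\in E(H)$. A neighborhood-prime labeling of a graph $G$ of order $n$ is a bijection $f:V(G)\to[n]$ such that for every vertex $v$ of degree greater than $1$, $\gcd\{f(u):u\in N(v)\}=1$; a graph is neighborhood-prime if it has such a labeling. The set $\mathcal{N}(G)$ of neighborhood graphs of $G$ consists of all graphs $H$ with $V(H)=V(G)$ obtained as follows: for each $v\in V(G)$ with $\deg_G(v)\ge 2$ choose exactly one pair of distinct vertices $u,w\in N(v)$, and let $E(H)$ be the set of all chosen pairs $uw$ (a pair chosen for several $v$ is counted once). *)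

(* Defs.v *)
From mathcomp Require Import all_boot.

Set Implicit Arguments.
Unset Strict Implicit.
Unset Printing Implicit Defensive.

Record sgraph (T : finType) := SGraph {
  adj :> rel T;
  adj_sym : symmetric adj;
  adj_irr : irreflexive adj
}.

Definition nbr (T : finType) (G : sgraph T) (v : T) : {set T} :=
  [set u | G v u].

Definition deg (T : finType) (G : sgraph T) (v : T) : nat := #|nbr G v|.

(* A bijection V(G) -> {1, ..., n} is encoded as a bijection f onto
   'I_n = {0, ..., n-1}, n = #|T|; the actual label of v is (f v).+1. *)
Definition label (T : finType) (f : T -> 'I_#|T|) (v : T) : nat := (f v).+1.

Definition prime_labeling (T : finType) (G : sgraph T) (f : T -> 'I_#|T|) : Prop :=
  bijective f /\
  forall u w : T, G u w -> gcdn (label f u) (label f w) = 1.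

(* 0 is the neutral element of gcdn. *)
Definition nbr_prime_labeling (T : finType) (G : sgraph T) (f : T -> 'I_#|T|) : Prop :=
  bijective f /\
  forall v : T, 1 < deg G v -> \big[gcdn/0]_(u in nbr G v) label f u = 1.

Definition neighborhood_prime (T : finType) (G : sgraph T) : Prop :=
  exists f : T -> 'I_#|T|, nbr_prime_labeling G f.

(* c v is the unordered pair chosen for v; its value is irrelevant when
   deg G v < 2. *)
Definition neighborhood_graph (T : finType) (G H : sgraph T) : Prop :=
  exists c : T -> {set T},
    (forall v : T, 2 <= deg G v -> c v \subset nbr G v /\ #|c v| = 2) /\
    (forall x y : T, H x y <-> exists v : T, 2 <= deg G v /\ c v = [set x; y]).

(* Main.v *)
Require Import Defs.
From mathcomp Require Import all_boot.

(** A prime labeling of a neighborhood graph [H] is itself a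
    neighborhood-prime labeling of [G]: the pair chosen in the neighborhood of
    a vertex [v] of degree at least 2 is an edge of [H], so its two labels are
    coprime, and the gcd over the whole neighborhood divides theirs. *)

Theorem theorem31 (T : finType) (G : sgraph T) :
  (exists H : sgraph T, neighborhood_graph G H /\
     exists f : T -> 'I_#|T|, prime_labeling H f) ->
  neighborhood_prime G.
Proof.
move=> [H [[c [c_pair adjH]] [f [f_bij f_prime]]]].
exists f; split=> // v deg_v.
have [c_sub /eqP/cards2P [x [y [_ c_xy]]]] := c_pair v deg_v.
have Hxy : H x y by apply/adjH; exists v.
move: c_sub; rewrite c_xy subUset !sub1set => /andP [Nx Ny].
apply/eqP; rewrite -dvdn1 -(f_prime x y Hxy) dvdn_gcd.
by rewrite (biggcdn_inf x) ?(biggcdn_inf y).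
Qed.
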